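(* The set $\mathbb{R}_+$ of positive real numbers, equipped with $d^*(x,y)=\left|\frac{x}{y}\right|^*$, is a complete multiplicative metric space.
   Context: The multiplicative absolute value $|\cdot|^*:\mathbb{R}_+\to\mathbb{R}_+$ is defined by $|a|^*=a$ if $a\ge1$ and $|a|^*=\frac1a$ if $a<1$. A multiplicative metric on a nonempty set $X$ is a mapping $d:X\times X\to\mathbb{R}$ such that for all $x,y,z\in X$: (m1) $d(x,y)\ge 1$, and $d(x,y)=1$ if and only if $x=y$; (m2) $d(x,y)=d(y,x)$; (m3) $d(x,z)\le d(x,y)\cdot d(y,z)$. The pair $(X,d)$ is then called a multiplicative metric space. A sequence $(x_n)$ in $X$ is multiplicative convergent to $x\in X$ if for every $\varepsilon>1$ there is $N\in\mathbb{N}$ such that $d(x_n,x)<\varepsilon$ for all $n\ge N$. It is a multiplicative Cauchy sequence if for every $\varepsilon>1$ there is $N\in\mathbb{N}$ such that $d(x_m,x_n)<\varepsilon$ for all $m,n\ge N$. The space $(X,d)$ is complete if every multiplicative Cauchy sequence in $X$ is multiplicative convergent to some $x\in X$. *)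

(* Defs.v *)
(* The real numbers are an arbitrary [R : realType], and the set of positive
   reals is the library's subtype [{posnum R}]. *)
From HB Require Import structures.
From mathcomp Require Import all_boot all_order all_algebra.
From mathcomp Require Import interval_inference reals.

Set Implicit Arguments.
Unset Strict Implicit.
Unset Printing Implicit Defensive.

Import Order.TTheory GRing.Theory Num.Theory.

Local Open Scope ring_scope.

Section MultiplicativeMetric.
Variables (R : realType) (X : Type) (d : X -> X -> R).

Record multiplicative_metric : Prop := MultiplicativeMetric {
  mmetric_ge1 : forall x y, 1 <= d x y;
  mmetric_eq1 : forall x y, d x y = 1 <-> x = y;
  mmetric_sym : forall x y, d x y = d y x;
  mmetric_triangle : forall x y z, d x z <= d x y * d y z
}.

Definition multiplicative_metric_space : Prop :=
  inhabited X /\ multiplicative_metric.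

Definition multiplicative_convergent (u : nat -> X) (x : X) : Prop :=
  forall eps : R, 1 < eps ->
    exists N : nat, forall n : nat, (N <= n)%N -> d (u n) x < eps.

Definition multiplicative_cauchy (u : nat -> X) : Prop :=
  forall eps : R, 1 < eps ->
    exists N : nat, forall m n : nat,
      (N <= m)%N -> (N <= n)%N -> d (u m) (u n) < eps.

Definition multiplicative_complete : Prop :=
  forall u : nat -> X, multiplicative_cauchy u ->
    exists x : X, multiplicative_convergent u x.

Definition complete_multiplicative_metric_space : Prop :=
  multiplicative_metric_space /\ multiplicative_complete.

End MultiplicativeMetric.

Arguments complete_multiplicative_metric_space [R] X d.

Definition mult_abs (R : realType) (a : {posnum R}) : {posnum R} :=
  if 1 <= a%:num then a else (a%:num^-1)%:pos.

Definition dstar (R : realType) (x y : {posnum R}) : R :=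
  (mult_abs (x%:num / y%:num)%:pos)%:num.

(* Main.v *)
Require Import Defs.
From mathcomp Require Import all_boot all_order all_algebra.
From mathcomp Require Import interval_inference reals.
From mathcomp Require Import classical_sets.

(** Since [dstar x y] is the larger of [x / y] and [y / x], the inequality
    [dstar x y <= c] says that [x <= c y] and [y <= c x] ([dstar_le]); the
    metric axioms are immediate from this symmetric description.

    For completeness no logarithm is needed.  The candidate limit of a Cauchy
    sequence [u] is its lower limit, the supremum of the reals [r] that are
    eventually below [u].  If all terms from rank [N] on are within a factor
    [c] of each other, then for [m >= N] the number [u m / c] is eventually
    below [u], while every [r] eventually below [u] is at most [c * u m]; so
    the supremum exists, is positive, and lies within a factor [c] of [u m]
    ([eventual_lower_bound_ge] and [eventual_lower_bound_le]). *)

Import Order.TTheory GRing.Theory Num.Theory.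

Local Open Scope classical_set_scope.
Local Open Scope ring_scope.

Lemma dstarE (R : realType) (x y : {posnum R}) :
  dstar x y = Num.max (x%:num / y%:num) (y%:num / x%:num).
Proof.
rewrite /dstar /mult_abs /=; case: ifPn => [h|] /=.
  rewrite max_l //; apply: (le_trans _ h).
  by move: h; rewrite !ler_pdivlMr ?ler_pdivrMr ?mul1r.
rewrite -ltNge => h; rewrite max_r ?invf_div //.
apply: (le_trans (ltW h)).
by move: h; rewrite ltr_pdivrMr // ler_pdivlMr // !mul1r => /ltW.
Qed.

Lemma dstar_le (R : realType) (x y : {posnum R}) (c : R) :
  (dstar x y <= c) = (x%:num <= c * y%:num) && (y%:num <= c * x%:num).
Proof. by rewrite dstarE ge_max !ler_pdivrMr. Qed.

Lemma dstar_ge1 (R : realType) (x y : {posnum R}) : 1 <= dstar x y.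
Proof. by rewrite dstarE le_max !ler_pdivlMr // !mul1r le_total. Qed.

(** By [dstar_le], each axiom is a pair of inequalities; the triangle
    inequality chains [x <= d(x,y) y <= d(x,y) d(y,z) z] and its mirror
    image. *)
Lemma dstar_metric (R : realType) : multiplicative_metric (@dstar R).
Proof.
split=> [x y|x y|x y|x y z].
- exact: dstar_ge1.
- split=> [dxy|->]; last by rewrite dstarE divff // maxxx.
  apply/val_inj/eqP; rewrite eq_le /=.
  by have := lexx (dstar x y); rewrite {2}dxy dstar_le !mul1r.
- by rewrite !dstarE maxC.
- have := lexx (dstar x y); rewrite dstar_le => /andP[xy yx].
  have := lexx (dstar y z); rewrite dstar_le => /andP[yz zy].
  have ge0 a b : 0 <= dstar a b :> R := le_trans ler01 (dstar_ge1 _ a b).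
  rewrite dstar_le; apply/andP; split.
    by apply: (le_trans xy); rewrite -mulrA ler_wpM2l.
  by apply: (le_trans zy); rewrite (mulrC (dstar x y)) -mulrA ler_wpM2l.
Qed.

Definition eventual_lower_bound (R : realType) (u : nat -> {posnum R}) :=
  [set r : R | exists N, forall n, (N <= n)%N -> r <= (u n)%:num].

Section Tail.
Variables (R : realType) (u : nat -> {posnum R}) (c : R) (N : nat).
Hypothesis c_gt0 : 0 < c.
Hypothesis uN : forall m n, (N <= m)%N -> (N <= n)%N -> dstar (u m) (u n) < c.

Lemma eventual_lower_bound_ge m :
  (N <= m)%N -> eventual_lower_bound R u ((u m)%:num / c).
Proof.
move=> Nm; exists N => n Nn; rewrite ler_pdivrMr // mulrC.
by have := ltW (uN _ _ Nm Nn); rewrite dstar_le => /andP[].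
Qed.

(** A number eventually below [u] is below some term of rank at least both [N]
    and the rank from which it is a bound, and that term is within [c] of
    [u m]. *)
Lemma eventual_lower_bound_le m :
  (N <= m)%N -> ubound (eventual_lower_bound R u) (c * (u m)%:num).
Proof.
move=> Nm r [M uM]; apply: (le_trans (uM (maxn M N) (leq_maxl _ _))).
have := ltW (uN _ _ Nm (leq_maxr M N)).
by rewrite dstar_le => /andP[].
Qed.

Lemma has_sup_eventual_lower_bound : has_sup (eventual_lower_bound R u).
Proof.
split; first by exists ((u N)%:num / c); exact: eventual_lower_bound_ge.
by exists (c * (u N)%:num); exact: eventual_lower_bound_le.
Qed.

Lemma sup_eventual_lower_bound_gt0 : 0 < sup (eventual_lower_bound R u).
Proof.
apply: (@lt_le_trans _ _ ((u N)%:num / c)); first by rewrite divr_gt0.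
apply: ub_le_sup; last exact: eventual_lower_bound_ge.
exact: has_sup_eventual_lower_bound.2.
Qed.

(** The limit enters as a separate [x] with an equation because [sup] lives in
    [R], and the factor witnessing its positivity is fixed independently of
    the [c] used here. *)
Lemma dstar_sup_eventual_lower_bound_le (x : {posnum R}) m :
  x%:num = sup (eventual_lower_bound R u) -> (N <= m)%N -> dstar (u m) x <= c.
Proof.
move=> xE Nm; have [ne ub] := has_sup_eventual_lower_bound.
rewrite dstar_le xE; apply/andP; split.
  rewrite mulrC -ler_pdivrMr //.
  by apply: ub_le_sup => //; exact: eventual_lower_bound_ge.
by apply: ge_sup => //; exact: eventual_lower_bound_le.
Qed.

End Tail.

Lemma dstar_complete (R : realType) : multiplicative_complete (@dstar R).
Proof.
move=> u cu; have [N2 uN2] := cu 2 (ltr1n R 2).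
(* The factor [2] only serves to see that the supremum is positive. *)
pose x := PosNum (sup_eventual_lower_bound_gt0 R u 2 N2 (ltr0n R 2) uN2).
exists x => eps eps1.
(* The tail estimate is not strict, hence a factor strictly between
   [1] and [eps]. *)
have [c1 ceps] := midf_lt eps1.
have [N uN] := cu _ c1; exists N => n Nn; apply: le_lt_trans ceps.
apply: (dstar_sup_eventual_lower_bound_le _ _ _ _ _ uN) => //.
exact: lt_trans c1.
Qed.

Theorem mainTheorem4 (R : realType) :
  complete_multiplicative_metric_space {posnum R} (@dstar R).
Proof.
split; last exact: dstar_complete.
by split; [exact: (inhabits 1%:pos) | exact: dstar_metric].
Qed.
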